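(* Let $n\ge4$, let $z_1,\dots,z_n\in\mathbb{CP}^1$ be distinct with $z_{n-2}=1$, $z_{n-1}=0$, $z_n=\infty$, and let either (even degree) $E=\mathcal{O}(-k)\oplus\mathcal{O}(-k)$ with $1\le k\le n-1$ and parabolic weights $0\le\alpha_{i1}<\alpha_{i2}<1$, $\sum_i(\alpha_{i1}+\alpha_{i2})=2k$, satisfying $\sum_i\alpha_{i1}>k-1$ and $\alpha_{i2}+\alpha_{j2}+\sum_{l\ne i,j}\alpha_{l1}>k$ for all $i\ne j$ in $\{n-2,n-1,n\}$; or (odd degree) $E=\mathcal{O}(-(k+1))\oplus\mathcal{O}(-k)$ with $1\le k\le n-2$ and parabolic weights $0\le\alpha_{i1}<\alpha_{i2}<1$, $\sum_i(\alpha_{i1}+\alpha_{i2})=2k+1$, satisfying $k-1<\sum_i\alpha_{i1}<k$ and $\alpha_{i2}+\sum_{j\ne i}\alpha_{j1}>k$ for all $i=1,\dots,n$. Let $\mathcal{N}$ be the moduli space of stable parabolic bundles of degree $\deg(E)$ with these weights, and model $T^*\mathcal{N}$ as the space of $\mathrm{Aut}(E)$-orbits in $\mathcal{Q}^s_{\mathrm{even}}$ (resp. $\mathcal{Q}^s_{\mathrm{odd}}$). Then, on normalized representatives $(\mathbf{F},\Phi)$ in $\mathcal{Q}^s_{\mathrm{even}}$ (resp. $\mathcal{Q}^s_{\mathrm{odd}}$), the nilpotent cone locus on $T^*\mathcal{N}$ is determined by the equations $$\sum_{\substack{j=1\\ j\ne i}}^{n-1}\frac{\mathrm{tr}(B_iB_j)}{z_i-z_j}=0,\qquad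 i=1,\dots,n-3;$$ that is, such a $(\mathbf{F},\Phi)$ satisfies $\mathrm{tr}(\Phi^2)=0$ if and only if these equations hold.
   Context: Parabolic bundles. A rank 2 parabolic bundle $E_*$ of parabolic degree $0$ on $\mathbb{CP}^1$ is a holomorphic rank 2 bundle $E$ with lines $L_i\subset E|_{z_i}$ (flags $F_i=\{E|_{z_i}\supset L_i\supset\{0\}\}$) and weights $0\le\alpha_{i1}<\alpha_{i2}<1$ with $\deg(E)+\sum_i(\alpha_{i1}+\alpha_{i2})=0$. It is stable if every line subbundle $L\hookrightarrow E$ satisfies $\deg(L)+\sum_i\alpha_i'<0$, where $\alpha_i'=\alpha_{i2}$ if $L|_{z_i}=L_i$ and $\alpha_i'=\alpha_{i1}$ otherwise. $\mathcal{F}_i=\mathbb{P}(E|_{z_i})$, and $\mathcal{P}^s\subset\mathcal{F}_1\times\cdots\times\mathcal{F}_n$ is the set of $n$-tuples of flags $\mathbf{F}=(F_1,\dots,F_n)$ making $E$ stable parabolic. For the given weights every stable parabolic bundle has underlying bundle isomorphic to $E$, and $\mathcal{N}\cong P(\mathrm{Aut}(E))\backslash\mathcal{P}^s$, where $P(\mathrm{Aut}(E))$ is $\mathrm{Aut}(E)$ modulo nonzero scalars. In the even case the space $\mathbb{CP}^1$ of subbundles $\mathcal{O}(-k)\hookrightarrow E$ identifies all $\mathcal{F}_i$ with $\mathbb{CP}^1$ by restriction. In the odd case $\mathcal{F}_i^0=\mathcal{F}_i\setminus\{\mathcal{O}(-k)|_{z_i}\}\cong\mathbb{C}$, with affine coordinate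 $u_i$ denoting the line spanned by $(1,u_i)$ in a frame adapted to the splitting, and $\mathcal{P}^s\subset\mathcal{F}_1^0\times\cdots\times\mathcal{F}_n^0$. Parabolic Higgs fields. A parabolic Higgs field on $E_*$ is a meromorphic $\mathrm{End}(E)$-valued differential $\Phi$, holomorphic off $\{z_1,\dots,z_n\}$, with at most simple poles at the $z_i$ whose residues lie in $\mathfrak{n}(F_i)$, the space of nilpotent endomorphisms of $E|_{z_i}$ whose kernel contains $L_i$. When $E_*$ is stable these form the cotangent space of $\mathcal{N}$ at the class of $E_*$. The nilpotent cone locus on $T^*\mathcal{N}$ is the set of classes of pairs $(E_*,\Phi)$ with $E_*$ stable and $\mathrm{tr}(\Phi^2)=0$. Explicit models. Let $\mathcal{V}$ be the set of nilpotent complex $2\times2$ matrices and $\mathcal{V}'\subset\mathcal{V}$ the set of matrices $B=c\begin{pmatrix}-u & 1\\ -u^2 & u\end{pmatrix}$ with $c,u\in\mathbb{C}$ (kernel line of coordinate $u$ when $c\ne0$). Using the affine trivialization of $E$ over $\mathbb{C}=\mathbb{CP}^1\setminus\{\infty\}$ given by the splitting, $\mathcal{H}_{\mathrm{even}}$ is the space of differentials $$\Phi(z)=\Big(\sum_{i=1}^{n-1}\frac{B_i}{z-z_i}\Big)dz,\quad B_i\in\mathcal{V},\quad B_n:=-\sum_{i=1}^{n-1}B_i\in\mathcal{V},$$ and $\mathcal{H}_{\mathrm{odd}}$ is the space of differentials $$\Phi(z)=\Big(\sum_{i=1}^{n-1}\frac{B_i}{z-z_i}+c_n\begin{pmatrix}0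 & 0\\ {u_n^2} & 0\end{pmatrix}\Big)dz,\quad B_i=c_i\begin{pmatrix}-u_i & 1\\ -u_i^2 & u_i\end{pmatrix}\in\mathcal{V}',$$ such that $\mathrm{Ad}\begin{pmatrix}z^{k+1} & 0\\ 0 & z^k\end{pmatrix}(\Phi)$ has at most a simple pole at $z=\infty$ with residue $B_n:=c_n\begin{pmatrix}-u_n & 1\\ -u_n^2 & u_n\end{pmatrix}$. These are the local expressions over $\mathbb{C}$ of the parabolic Higgs fields on $E$ (in the odd case, for flags in $\mathcal{F}^0_1\times\cdots\times\mathcal{F}^0_n$). Set $$\mathcal{Q}^s_{\mathrm{even}}=\{(\mathbf{F},\Phi)\in\mathcal{P}^s\times\mathcal{H}_{\mathrm{even}}: B_i\in\mathfrak{n}(F_i),\ i=1,\dots,n\},$$ and similarly $\mathcal{Q}^s_{\mathrm{odd}}$ with $\mathcal{H}_{\mathrm{odd}}$. $\mathrm{Aut}(E)$ acts on flags by restriction to fibers and on $\Phi$ by conjugation, and $T^*\mathcal{N}\cong\mathrm{Aut}(E)\backslash\mathcal{Q}^s_{\mathrm{even}}$ (resp. $\mathrm{Aut}(E)\backslash\mathcal{Q}^s_{\mathrm{odd}}$). Normalization. In even degree, $(\mathbf{F},\Phi)$ is normalized if $L_{n-2},L_{n-1},L_n$ have fixed pairwise distinct values $1,0,\infty$ in $\mathbb{CP}^1$. In odd degree, it is normalized if $u_{n-1}=u_n=0$ for the flags $F_{n-1},F_n$ (so that the $c_n u_n^2$ term of $\Phi$ vanishes). Every $\mathrm{Aut}(E)$-orbit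 has a normalized representative. *)

(* Defs.v *)
(* Mathematical Components; the field of complex numbers is R[i] for a real
   number structure R : realType. *)
From HB Require Import structures.
From mathcomp Require Export all_boot all_order all_algebra.
From mathcomp Require Export complex.
From mathcomp Require Export classical_sets reals.

Set Implicit Arguments.
Unset Strict Implicit.
Unset Printing Implicit Defensive.

Export Order.TTheory GRing.Theory Num.Theory.

Local Open Scope ring_scope.
Local Open Scope classical_set_scope.

(* The Riemann sphere; None is the point at infinity. *)
Definition CP1 (R : realType) : Type := option R[i].

(* Affine coordinate of a point of the sphere; the value at infinity is junk. *)
Definition affine (R : realType) (p : CP1 R) : R[i] := odflt 0 p.

Definition mx2 (T : Type) (a b c d : T) : 'M[T]_2 :=
  \matrix_(i, j) if i == ord0 then (if j == ord0 then a else b)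
                 else (if j == ord0 then c else d).

Definition col2 (T : Type) (a b : T) : 'cV[T]_2 :=
  \col_i if i == ord0 then a else b.

(* Marked points are indexed by 'I_n, starting from 0; the point usually written
   with index n - j is [from_last hn j]. *)
Lemma from_last_subproof (n : nat) (hn : (3 < n)%N) (j : nat) :
  (n - j.+1 < n)%N.
Proof. by rewrite ltn_subrL (ltn_trans _ hn). Qed.

Definition from_last (n : nat) (hn : (3 < n)%N) (j : nat) : 'I_n :=
  Ordinal (from_last_subproof hn j).

(* ** Split bundles on the sphere *)

(* The bundle O(a_0) + ... + O(a_(r-1)) is given by a frame over C (coordinate x)
   and a frame over the complement of 0 (coordinate w = 1/x): a section with
   components s_i(x) in the first frame has components x^(- a_i) s_i(x) in the
   second one.  A homomorphism from the sum of the O(b_j) to the sum of the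
   O(a_i) is a pair of matrices, hom0 over C and hom8 near infinity, related by
   this change of frames.  Their entries are polynomials in x, resp. in w: every
   holomorphic homomorphism is of this form, since homomorphisms from O(b) to
   O(a) are the sections of O(a - b). *)
Record bundle_hom (R : realType) (r s : nat)
    (a : 'I_r -> int) (b : 'I_s -> int) := BundleHom {
  hom0 : 'M[{poly R[i]}]_(r, s);
  hom8 : 'M[{poly R[i]}]_(r, s);
  hom_glue : forall i j (x : R[i]), x != 0 ->
    (hom8 i j).[x^-1] = x ^ (b j - a i) * (hom0 i j).[x] }.

(* The map induced on the fiber at p, in the frame over C at finite points and
   in the frame near infinity at infinity. *)
Definition fiber (R : realType) (r s : nat) (a : 'I_r -> int) (b : 'I_s -> int)
    (h : bundle_hom R a b) (p : CP1 R) : 'M[R[i]]_(r, s) :=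
  match p with
  | Some x => map_mx (fun q : {poly R[i]} => q.[x]) (hom0 h)
  | None => map_mx (fun q : {poly R[i]} => q.[0]) (hom8 h)
  end.

Definition is_line_subbundle (R : realType) (a : 'I_2 -> int) (d : int)
    (l : bundle_hom R a (fun _ : 'I_1 => d)) : Prop :=
  forall p : CP1 R, fiber l p != 0.

Definition is_automorphism (R : realType) (a : 'I_2 -> int)
    (g : bundle_hom R a a) : Prop :=
  forall p : CP1 R, fiber g p \in unitmx.

(* O(-k) + O(-k) *)
Definition E_even (k : nat) : 'I_2 -> int := fun=> - k%:Z.

(* O(-(k+1)) + O(-k) *)
Definition E_odd (k : nat) : 'I_2 -> int :=
  fun i => if i == ord0 then - k.+1%:Z else - k%:Z.

(* ** Flags and stability *)

(* A flag at a point is a line in the fiber, the fiber being identified with C^2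
   by the frames used in [fiber]. *)
Definition flags (R : realType) (n : nat) : Type :=
  'I_n -> {vspace 'cV[R[i]]_2}.

Definition is_flags (R : realType) (n : nat) (L : flags R n) : Prop :=
  forall i, \dim (L i) = 1%N.

(* The line of coordinate u, and the line of coordinate infinity. *)
Definition line (R : realType) (u : R[i]) : {vspace 'cV[R[i]]_2} :=
  <[col2 1%R u]>%VS.
Definition line_infty (R : realType) : {vspace 'cV[R[i]]_2} :=
  <[col2 0%R 1%R]>%VS.

Definition is_weights (R : realType) (n : nat) (al1 al2 : 'I_n -> R) : Prop :=
  forall i, [/\ 0 <= al1 i, al1 i < al2 i & al2 i < 1].

Definition stable (R : realType) (n : nat) (z : 'I_n -> CP1 R)
    (a : 'I_2 -> int) (al1 al2 : 'I_n -> R) (L : flags R n) : Prop :=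
  forall (d : int) (l : bundle_hom R a (fun _ : 'I_1 => d)),
    is_line_subbundle l ->
    d%:~R + \sum_i (if <[fiber l (z i)]>%VS == L i then al2 i else al1 i) < 0.

Definition Ps (R : realType) (n : nat) (z : 'I_n -> CP1 R) (a : 'I_2 -> int)
    (al1 al2 : 'I_n -> R) : set (flags R n) :=
  [set L | is_flags L /\ stable z a al1 al2 L].

(* ** Parabolic Higgs fields *)

(* Matrices Phi of rational functions stand for the differentials Phi(x) dx,
   written in the frame over C. *)
Definition ratmx (R : realType) : Type := 'M[{fraction {poly R[i]}}]_2.

Definition ratC (R : realType) (c : R[i]) : {fraction {poly R[i]}} :=
  tofrac (c%:P).

(* f tends to c at infinity. *)
Definition value_at_infty (R : realType) (f : {fraction {poly R[i]}})
    (c : R[i]) : Prop :=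
  exists p q : {poly R[i]},
    [/\ q != 0, f * tofrac q = tofrac p, (size p <= size q)%N
      & p`_(size q).-1 = c * lead_coef q].

(* In the coordinate w = 1/x one has f dx = - (x f) dw / w, so f dx has at most
   a simple pole at infinity, with residue c, iff - x f tends to c. *)
Definition simple_pole_at_infty (R : realType) (Phi : ratmx R)
    (B : 'M[R[i]]_2) : Prop :=
  forall i j, value_at_infty (- (tofrac 'X * Phi i j)) (B i j).

Definition nilpotent_mx (R : realType) (B : 'M[R[i]]_2) : Prop :=
  exists m : nat, B ^+ m = 0.

Definition nilp_flag (R : realType) (L : {vspace 'cV[R[i]]_2}) :
    set 'M[R[i]]_2 :=
  [set B | nilpotent_mx B /\ forall v, v \in L -> B *m v = 0].

(* c times the matrix with rows (-u, 1) and (-u^2, u). *)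
Definition Bmx (R : realType) (c u : R[i]) : 'M[R[i]]_2 :=
  c *: mx2 (- u) 1 (- u ^+ 2) u.

(* The sum of the B_i / (x - z_i) over the finite marked points. *)
Definition polar_part (R : realType) (n : nat) (hn : (3 < n)%N)
    (z : 'I_n -> CP1 R) (B : 'I_n -> 'M[R[i]]_2) : ratmx R :=
  \sum_(i < n | i != from_last hn 0)
    (tofrac ('X - (affine (z i))%:P))^-1 *: map_mx (@ratC R) (B i).

(* Phi belongs to H_even, with residues B_i. *)
Definition H_even (R : realType) (n : nat) (hn : (3 < n)%N)
    (z : 'I_n -> CP1 R) (Phi : ratmx R) (B : 'I_n -> 'M[R[i]]_2) : Prop :=
  [/\ forall i, nilpotent_mx (B i),
      B (from_last hn 0) = - \sum_(i < n | i != from_last hn 0) B i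
    & Phi = polar_part hn z B].

(* Phi belongs to H_odd, with parameters c_i and u_i; its residues are the
   Bmx (c i) (u i). *)
Definition H_odd (R : realType) (n : nat) (hn : (3 < n)%N)
    (z : 'I_n -> CP1 R) (k : nat) (Phi : ratmx R) (c u : 'I_n -> R[i]) : Prop :=
  let iN := from_last hn 0 in
  let X : {fraction {poly R[i]}} := tofrac 'X in
  let D : ratmx R := mx2 (X ^+ k.+1) 0 0 (X ^+ k) in
  Phi = polar_part hn z (fun i => Bmx (c i) (u i))
        + map_mx (@ratC R) (c iN *: mx2 0 0 (u iN ^+ 2) 0)
  /\ simple_pole_at_infty (D *m Phi *m invmx D) (Bmx (c iN) (u iN)).

Definition higgs_pair (R : realType) (n : nat) : Type :=
  (flags R n * ratmx R)%type.

Definition Q_even (R : realType) (n : nat) (hn : (3 < n)%N)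
    (z : 'I_n -> CP1 R) (k : nat) (al1 al2 : 'I_n -> R) :
    set (higgs_pair R n) :=
  [set x | Ps z (E_even k) al1 al2 x.1 /\
     exists B, H_even hn z x.2 B /\ forall i, nilp_flag (x.1 i) (B i)].

Definition Q_odd (R : realType) (n : nat) (hn : (3 < n)%N)
    (z : 'I_n -> CP1 R) (k : nat) (al1 al2 : 'I_n -> R) :
    set (higgs_pair R n) :=
  [set x | Ps z (E_odd k) al1 al2 x.1 /\
     exists c u, H_odd hn z k x.2 c u /\
       forall i, nilp_flag (x.1 i) (Bmx (c i) (u i))].

(* ** The action of Aut(E), and the nilpotent cone *)

Definition aut_act (R : realType) (n : nat) (z : 'I_n -> CP1 R)
    (a : 'I_2 -> int) (g : bundle_hom R a a) (x : higgs_pair R n) :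
    higgs_pair R n :=
  let G : ratmx R := map_mx (@tofrac _) (hom0 g) in
  (fun i => (linfun (mulmx (fiber g (z i))) @: x.1 i)%VS,
   G *m x.2 *m invmx G).

Definition orbit (R : realType) (n : nat) (z : 'I_n -> CP1 R)
    (a : 'I_2 -> int) (x : higgs_pair R n) : set (higgs_pair R n) :=
  [set y | exists2 g : bundle_hom R a a, is_automorphism g & y = aut_act z g x].

(* The model of the cotangent space: the set of Aut(E)-orbits in Q. *)
Definition cotangent (R : realType) (n : nat) (z : 'I_n -> CP1 R)
    (a : 'I_2 -> int) (Q : set (higgs_pair R n)) : set (set (higgs_pair R n)) :=
  [set orbit z a x | x in Q].

Definition nilpotent_cone (R : realType) (n : nat) (z : 'I_n -> CP1 R)
    (a : 'I_2 -> int) (Q : set (higgs_pair R n)) : set (set (higgs_pair R n)) :=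
  [set o | cotangent z a Q o /\
     exists x, [/\ Q x, orbit z a x = o & \tr (x.2 *m x.2) = 0]].

Definition normalized_even (R : realType) (n : nat) (hn : (3 < n)%N)
    (x : higgs_pair R n) : Prop :=
  [/\ x.1 (from_last hn 2) = line 1, x.1 (from_last hn 1) = line 0
    & x.1 (from_last hn 0) = line_infty R].

Definition normalized_odd (R : realType) (n : nat) (hn : (3 < n)%N)
    (x : higgs_pair R n) : Prop :=
  x.1 (from_last hn 1) = line 0 /\ x.1 (from_last hn 0) = line 0.

Definition cone_equations (R : realType) (n : nat) (hn : (3 < n)%N)
    (z : 'I_n -> CP1 R) (B : 'I_n -> 'M[R[i]]_2) : Prop :=
  forall i : 'I_n, (i < n - 3)%N ->
    \sum_(j < n | (j != i) && (j != from_last hn 0))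
      \tr (B i *m B j) / (affine (z i) - affine (z j)) = 0.

(* Main.v *)
(* Partial fractions turn tr(Phi^2) into the sum of 2 r_i / (x - z_i), where
   r_i = sum_(j != i) tr(B_i B_j) / (z_i - z_j), because the residues are
   nilpotent; so tr(Phi^2) = 0 means that all the r_i vanish.  By antisymmetry
   sum r_i = 0, and 2 sum z_i r_i = tr((sum B_i)^2), which is zero since the sum
   of the residues at finite points is nilpotent.  In odd degree that nilpotency
   uses the normalization at infinity: it gives c_n u_n = 0, and the pole
   condition at infinity then yields sum c_i u_i = sum c_i = 0. *)
From HB Require Import structures.
From mathcomp Require Import zify ring.
Require Import Defs.

Set Implicit Arguments.
Unset Strict Implicit.
Unset Printing Implicit Defensive.

Local Open Scope ring_scope.

HB.instance Definition _ (R : realType) :=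
  GRing.RMorphism.copy (@ratC R) (@tofrac {poly R[i]} \o @polyC R[i]).

(** * Antisymmetric sums over pairs of points *)

Section PairSums.
Variables (F : fieldType) (n : nat) (P : pred 'I_n) (x : 'I_n -> F).
Hypothesis char_neq2 : (2%:R : F) != 0.
Hypothesis x_inj : {in P &, injective x}.
Variable t : 'I_n -> 'I_n -> F.
Hypothesis t_sym : forall i j, t i j = t j i.
Hypothesis t_diag : forall i, P i -> t i i = 0.

(** Adding the double sum to its copy with [i] and [j] exchanged replaces [w i] by [w i - w j],
    since [t] is symmetric and the denominator changes sign. The diagonal is harmless because
    [t i i = 0]. *)
Lemma double_pair_sum (w : 'I_n -> F) :
  2%:R * (\sum_(i | P i) w i * (\sum_(j | (j != i) && P j) t i j / (x i - x j)))
  = \sum_(i | P i) \sum_(j | P j) (w i - w j) * (t i j / (x i - x j)).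
Proof.
have -> : \sum_(i | P i) w i * (\sum_(j | (j != i) && P j) t i j / (x i - x j))
    = \sum_(i | P i) \sum_(j | P j) w i * (t i j / (x i - x j)).
  apply: eq_bigr => i Pi; rewrite mulr_sumr [RHS](bigD1 i) //=.
  by rewrite t_diag // mul0r mulr0 add0r; apply: eq_bigl => j; rewrite andbC.
rewrite mulr2n mulrDl mul1r {2}exchange_big /= -big_split /=.
apply: eq_bigr => i Pi; rewrite -big_split /=; apply: eq_bigr => j Pj.
by rewrite (t_sym j i) -(opprB (x i)) invrN !mulrN mulrBl.
Qed.

Lemma pair_sum0 :
  \sum_(i | P i) (\sum_(j | (j != i) && P j) t i j / (x i - x j)) = 0.
Proof.
apply: (mulfI char_neq2); have /= := double_pair_sum (fun=> 1).
under eq_bigr do rewrite mul1r.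
move=> ->; rewrite mulr0 big1 // => i _; rewrite big1 // => j _.
by rewrite subrr mul0r.
Qed.

(** For the weight [w = x] the factor [x i - x j] cancels the denominator. *)
Lemma pair_sum1 :
  2%:R * (\sum_(i | P i) x i *
    (\sum_(j | (j != i) && P j) t i j / (x i - x j)))
  = \sum_(i | P i) \sum_(j | P j) t i j.
Proof.
rewrite double_pair_sum; apply: eq_bigr => i Pi; apply: eq_bigr => j Pj.
have [->|nij] := eqVneq i j; first by rewrite t_diag // mul0r mulr0.
by rewrite mulrC divfK // subr_eq0; apply: contra nij => /eqP /x_inj ->.
Qed.

End PairSums.

(** * Two by two matrices *)

Lemma ord2P (i : 'I_2) : (i = 0) + (i = 1).
Proof. by case: i => -[|[|//]] Hi; [left | right]; exact: val_inj. Qed.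

Lemma big_ord2 (V : nmodType) (f : 'I_2 -> V) : \sum_i f i = f 0 + f 1.
Proof.
by rewrite !big_ord_recl big_ord0 addr0; congr (_ + f _); exact: val_inj.
Qed.

Lemma mulmx22 (T : pzRingType) (A B : 'M[T]_2) i j :
  (A *m B) i j = A i 0 * B 0 j + A i 1 * B 1 j.
Proof. by rewrite mxE big_ord2. Qed.

Lemma conj_diag_powers (F : fieldType) (X : F) (k : nat) (M : 'M[F]_2) :
  let D := mx2 (X ^+ k.+1) 0 0 (X ^+ k) in
  X != 0 -> (D *m M *m invmx D) 0 0 = M 0 0
         /\ (D *m M *m invmx D) 0 1 = X * M 0 1.
Proof.
move=> D X0; pose D' := mx2 (X ^- k.+1) 0 0 (X ^- k).
have DD' : D *m D' = 1%:M.
  apply/matrixP=> a b; rewrite mulmx22 !mxE.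
  by case: (ord2P a) => ->; case: (ord2P b) => -> /=;
    rewrite ?mul0r ?mulr0 ?addr0 ?add0r ?mulfV ?expf_neq0.
have [D_unit _] := mulmx1_unit DD'.
have -> : invmx D = D' by rewrite -[RHS](mulKmx D_unit) DD' mulmx1.
split; rewrite !mulmx22 !mxE /= !mul0r !mulr0 !(add0r, addr0) mulrAC.
  by rewrite mulfV ?mul1r ?expf_neq0.
by rewrite exprS mulfK ?expf_neq0.
Qed.

Lemma det22 (T : comPzRingType) (A : 'M[T]_2) :
  \det A = A 0 0 * A 1 1 - A 0 1 * A 1 0.
Proof.
rewrite (expand_det_row _ 0) big_ord2 /cofactor !det_mx11 !mxE /=.
rewrite expr0 expr1 mul1r mulN1r mulrN.
by do !(congr (_ + _) || congr (- _) || congr (_ * _));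
  congr (A _ _); exact: val_inj.
Qed.

(** Since det B = 0, Cayley-Hamilton gives B^2 = tr(B) B, hence B^(j+1) = tr(B)^j B; nilpotency then
    forces B = 0 or tr(B) = 0. *)
Lemma tr_sqr_nilpotent (R : realType) (B : 'M[R[i]]_2) :
  nilpotent_mx B -> \tr (B *m B) = 0.
Proof.
case=> m Bm0.
have det_exp j : \det (B ^+ j) = \det B ^+ j.
  by elim: j => [|j IH]; rewrite ?det1 // !exprS -IH -det_mulmx.
have detB : \det B = 0.
  apply/eqP; have /eqP := det_exp m.
  by rewrite Bm0 det0 eq_sym expf_eq0 => /andP[].
have sqB : B *m B = \tr B *: B.
  move: detB; rewrite det22 => /eqP; rewrite subr_eq0 => /eqP dB.
  apply/matrixP=> a b; rewrite mulmx22 /mxtrace big_ord2 !mxE.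
  by case: (ord2P a) => ->; case: (ord2P b) => ->; ring: dB.
have expB j : B ^+ j.+1 = \tr B ^+ j *: B.
  elim: j => [|j IH]; first by rewrite expr0 scale1r.
  by rewrite exprS IH -scalerAr -[B * B]/(B *m B) sqB scalerA -exprSr.
rewrite sqB mxtraceZ.
have : \tr B ^+ m *: B = 0 by rewrite -expB exprS Bm0 mulr0.
move/eqP; rewrite scaler_eq0 => /orP[|/eqP->]; last by rewrite mxtrace0 mulr0.
by rewrite expf_eq0 => /andP[_ /eqP->]; rewrite mul0r.
Qed.

(** * Limits of rational functions at infinity *)

Section Infinity.
Variable R : realType.
Implicit Types (f g : {fraction {poly R[i]}}) (c d : R[i]).

(** A single strict degree inequality survives multiplication by a nonzero polynomial; uniqueness
    and additivity of the limit rest on this. *)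
Lemma value_at_inftyP f c :
  value_at_infty f c <-> exists p q : {poly R[i]},
    [/\ q != 0, f * tofrac q = tofrac p & (size (p - c *: q)%R < size q)%N].
Proof.
split=> -[p [q]].
  case=> q0 E spq top; exists p, q; split=> //.
  rewrite ltn_neqAle; apply/andP; split; last first.
    rewrite (leq_trans (size_polyD _ _)) // geq_max size_polyN spq.
    by rewrite (leq_trans (size_scale_leq _ _)).
  apply/eqP => eqs; have : lead_coef (p - c *: q) != 0.
    by rewrite lead_coef_eq0 -size_poly_eq0 eqs size_poly_eq0.
  by rewrite lead_coefE eqs coefB coefZ top subrr eqxx.
case=> q0 E lt_s; exists p, q; split=> //.
  rewrite -[p](subrK (c *: q)) (leq_trans (size_polyD _ _)) // geq_max.
  by rewrite ltnW ?size_scale_leq.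
apply/eqP; rewrite lead_coefE -coefZ -subr_eq0 -coefB nth_default //.
by rewrite -ltnS (leq_trans lt_s) // leqSpred.
Qed.

Lemma ltn_size_mul2r (p q r : {poly R[i]}) :
  r != 0 -> (size p < size q)%N -> (size (p * r)%R < size (q * r)%R)%N.
Proof.
move=> r0 lt_pq; have q0 : q != 0 by rewrite -size_poly_gt0 (leq_trans _ lt_pq).
have [->|p0] := eqVneq p 0.
  by rewrite mul0r size_poly0 size_poly_gt0 mulf_neq0.
rewrite !size_mul // -(prednK (n := size r)) ?size_poly_gt0 // !addnS /=.
by rewrite ltn_add2r.
Qed.

Lemma value_at_infty_uniq f c d :
  value_at_infty f c -> value_at_infty f d -> c = d.
Proof.
move=> /value_at_inftyP[p [q [q0 E lt_p]]] /value_at_inftyP[r [s [s0 G lt_r]]].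
have Eps : p * s = r * q.
  by apply/eqP; rewrite -tofrac_eq !tofracM -E -G mulrAC.
apply/eqP; rewrite -subr_eq0; apply/negPn/negP => ncd.
(* Over the common denominator [q * s], the difference of the two small remainders is
   [(c - d) *: (q * s)], whose degree is too large if [c] and [d] differ. *)
have : (size ((c - d) *: (q * s))%R < size (q * s)%R)%N.
  have -> : (c - d) *: (q * s) = (r - d *: s) * q - (p - c *: q) * s.
    by rewrite !mulrBl Eps -!scalerAl scalerBl (mulrC s); ring.
  rewrite (leq_ltn_trans (size_polyD _ _)) // gtn_max size_polyN.
  apply/andP; split.
    by rewrite [q * s]mulrC ltn_size_mul2r.
  by rewrite ltn_size_mul2r.
by rewrite size_scale // ltnn.
Qed.

Lemma value_at_inftyD f g c d : value_at_infty f c -> value_at_infty g d ->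
  value_at_infty (f + g) (c + d).
Proof.
move=> /value_at_inftyP[p [q [q0 E lt_p]]] /value_at_inftyP[r [s [s0 G lt_r]]].
apply/value_at_inftyP; exists (p * s + r * q), (q * s); split.
- by rewrite mulf_neq0.
- by rewrite tofracD !tofracM -E -G; ring.
have -> : p * s + r * q - (c + d) *: (q * s)
    = (p - c *: q) * s + (r - d *: s) * q.
  by rewrite !mulrBl -!scalerAl scalerDl (mulrC s); ring.
rewrite (leq_ltn_trans (size_polyD _ _)) // gtn_max; apply/andP; split.
  by rewrite ltn_size_mul2r.
by rewrite [q * s]mulrC ltn_size_mul2r.
Qed.

Lemma value_at_inftyN f c : value_at_infty f c -> value_at_infty (- f) (- c).
Proof.
case=> p [q [q0 E spq top]]; exists (- p), q; split; rewrite ?size_polyN //.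
  by rewrite mulNr E tofracN.
by rewrite coefN top mulNr.
Qed.

Lemma value_at_infty_const c : value_at_infty (ratC c) c.
Proof.
exists c%:P, 1; split; first exact: oner_neq0.
- by rewrite tofrac1; exact: mulr1.
- by rewrite size_poly1; exact: size_polyC_leq1.
- by rewrite size_poly1 lead_coef1 mulr1 coefC.
Qed.

Lemma value_at_infty_sum (I : finType) (P : pred I)
    (f : I -> {fraction {poly R[i]}}) (c : I -> R[i]) :
  (forall i, P i -> value_at_infty (f i) (c i)) ->
  value_at_infty (\sum_(i | P i) f i) (\sum_(i | P i) c i).
Proof.
move=> fc; apply: (big_ind2 (@value_at_infty R)) => //.
  by have := value_at_infty_const 0; rewrite rmorph0.
by move=> *; apply: value_at_inftyD.
Qed.

Lemma value_at_infty_decay f c :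
  value_at_infty (tofrac 'X * f) c -> value_at_infty f 0.
Proof.
case=> p [q [q0 E spq _]]; exists p, ('X * q).
have sXq : size ('X * q) = (size q).+1 by rewrite mulrC size_mulX.
split.
- by rewrite mulf_neq0 // polyX_eq0.
- by rewrite tofracM mulrA (mulrC f).
- by rewrite sXq leqW.
- by rewrite sXq mul0r nth_default.
Qed.

Lemma value_at_infty_pole c d :
  value_at_infty (tofrac 'X * ((tofrac ('X - d%:P))^-1 * ratC c)) c.
Proof.
have nz : tofrac ('X - d%:P) != 0 :> {fraction {poly R[i]}}.
  by rewrite tofrac_eq0 polyXsubC_eq0.
exists (c *: 'X), ('X - d%:P); split; first by rewrite polyXsubC_eq0.
- by rewrite -mul_polyC tofracM -mulrA (mulrC _^-1) divfK // mulrC.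
- by rewrite size_XsubC (leq_trans (size_scale_leq _ _)) // size_polyX.
- by rewrite size_XsubC lead_coefXsubC coefZ coefX.
Qed.

End Infinity.

(** * Partial fractions *)

Lemma mul_invf_sub (F : fieldType) (p q : F) :
  p != 0 -> q != 0 -> q - p != 0 -> p^-1 * q^-1 = (p^-1 - q^-1) * (q - p)^-1.
Proof. by move=> p0 q0 qp0; field; rewrite qp0 p0 q0. Qed.

Section PartialFractions.
Variables (R : realType) (n : nat) (P : pred 'I_n) (x : 'I_n -> R[i]).
Hypothesis x_inj : {in P &, injective x}.

Let fr (i : 'I_n) : {fraction {poly R[i]}} := (tofrac ('X - (x i)%:P))^-1.

Let lin_neq0 i : tofrac ('X - (x i)%:P) != 0 :> {fraction {poly R[i]}}.
Proof. by rewrite tofrac_eq0 polyXsubC_eq0. Qed.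

(** After denominators are cleared, evaluation at [x i] kills every term but the [i]-th, whose
    product of linear factors is nonzero because the points are distinct. *)
Lemma partial_fractions_free (r : 'I_n -> R[i]) :
  \sum_(i | P i) fr i * ratC (r i) = 0 -> forall i, P i -> r i = 0.
Proof.
move=> S0 i Pi; pose Q (j : 'I_n) := \prod_(l | P l && (l != j)) ('X - (x l)%:P).
have poly0 : \sum_(j | P j) (r j)%:P * Q j = 0.
  apply/eqP; rewrite -tofrac_eq0 rmorph_sum /=; apply/eqP.
  transitivity ((\sum_(j | P j) fr j * ratC (r j)) *
      tofrac (\prod_(l | P l) ('X - (x l)%:P))); last by rewrite S0 mul0r.
  rewrite mulr_suml.
  apply: eq_bigr => j Pj; rewrite (bigD1 j) //= !tofracM.
  by rewrite (mulrC (fr j)) -mulrA (mulrA (fr j)) mulVf ?mul1r ?lin_neq0.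
have := congr1 (horner^~ (x i)) poly0; rewrite horner0 horner_sum.
rewrite (bigD1 i) //= big1 => [|j /andP[Pj nij]]; last first.
  rewrite hornerM /Q (bigD1 i) /= ?Pi 1?eq_sym //.
  by rewrite hornerM hornerXsubC subrr mul0r mulr0.
rewrite addr0 hornerM hornerC => /eqP; rewrite mulf_eq0 => /orP[/eqP // |].
rewrite /Q horner_prod; under eq_bigr do rewrite hornerXsubC.
rewrite prodf_seq_eq0 => /hasP[l _ /andP[/andP[Pl nli]]].
by rewrite subr_eq0 => /eqP/x_inj E; rewrite -E ?eqxx in nli.
Qed.

(** The constant denominator is kept apart to match the shape [(w i - w j) * _] of
    [double_pair_sum], with [w = fr]. *)
Lemma partial_fraction_mul i j : x i != x j ->
  fr i * fr j = (fr i - fr j) * (ratC (x i - x j))^-1.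
Proof.
move=> nij.
have nz : ratC (x i - x j) != 0 by rewrite fmorph_eq0 subr_eq0.
have Ed : ratC (x i - x j) = tofrac ('X - (x j)%:P) - tofrac ('X - (x i)%:P).
  rewrite -tofracB /ratC polyCB; congr (tofrac _).
  by rewrite [RHS]addrC opprB addrA subrK.
by rewrite Ed in nz *; exact: (mul_invf_sub (lin_neq0 i) (lin_neq0 j) nz).
Qed.

End PartialFractions.

(** * The trace of the square and the cone equations *)

Section ConeEquations.
Variables (R : realType) (n : nat) (hn : (3 < n)%N) (z : 'I_n -> CP1 R).
Hypothesis z_inj : injective z.
Hypothesis z_one : z (from_last hn 2) = Some 1.
Hypothesis z_zero : z (from_last hn 1) = Some 0.
Hypothesis z_infty : z (from_last hn 0) = None.

(** As [z] is injective, only the excluded index lies at infinity, so the junk value of [affine]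
    never enters. *)
Lemma affine_inj : {in [pred i | i != from_last hn 0] &,
  injective (fun i => affine (z i))}.
Proof.
have fin i : i != from_last hn 0 -> exists y, z i = Some y.
  move=> ni; case E: (z i) => [y|]; first by exists y.
  by rewrite -z_infty in E; rewrite (z_inj E) eqxx in ni.
move=> i j /fin[a Ea] /fin[b Eb]; rewrite Ea Eb /= => ab.
by apply: z_inj; rewrite Ea Eb ab.
Qed.

Let P : pred 'I_n := fun i => i != from_last hn 0.
Let x (i : 'I_n) : R[i] := affine (z i).
Let fr (i : 'I_n) : {fraction {poly R[i]}} := (tofrac ('X - (x i)%:P))^-1.

Lemma polar_partE (B : 'I_n -> 'M[R[i]]_2) a b :
  polar_part hn z B a b = \sum_(i | P i) fr i * ratC (B i a b).
Proof. by rewrite summxE; apply: eq_bigr => i _; rewrite !mxE. Qed.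

Section Residues.
Variable B : 'I_n -> 'M[R[i]]_2.
Hypothesis trB2 : forall i, P i -> \tr (B i *m B i) = 0.

(** Half the residue at [x i] of the trace of the square; these sums have the form of Gaudin
    Hamiltonians. *)
Let r (i : 'I_n) : R[i] :=
  \sum_(j | (j != i) && P j) \tr (B i *m B j) / (x i - x j).

Lemma tr_sqr_polar_part :
  \tr (polar_part hn z B *m polar_part hn z B)
  = \sum_(i | P i) fr i * ratC (2%:R * r i).
Proof.
have -> : \tr (polar_part hn z B *m polar_part hn z B)
    = \sum_(i | P i) \sum_(j | P j) fr i * fr j * ratC (\tr (B i *m B j)).
  rewrite mulmx_suml raddf_sum; apply: eq_bigr => i _.
  rewrite mulmx_sumr raddf_sum; apply: eq_bigr => j _.
  by rewrite -scalemxAl -scalemxAr scalerA -map_mxM /= mxtraceZ trace_map_mx.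
(* [double_pair_sum] will be applied over the field of rational functions, with weights [fr] and the
   constants [x i] as points. *)
transitivity (2%:R * \sum_(i | P i) fr i * (\sum_(j | (j != i) && P j)
    ratC (\tr (B i *m B j)) / (ratC (x i) - ratC (x j)))); last first.
  rewrite mulr_sumr; apply: eq_bigr => i _; rewrite rmorphM rmorph_nat mulrCA.
  congr (_ * (_ * _)); rewrite rmorph_sum; apply: eq_bigr => j _.
  by rewrite fmorph_div rmorphB.
rewrite (@double_pair_sum _ _ P (fun i => ratC (x i))
  (fun i j => ratC (\tr (B i *m B j)))); first last.
- by move=> i Pi; rewrite trB2 ?rmorph0.
- by move=> i j; rewrite mxtrace_mulC.
apply: eq_bigr => i Pi; apply: eq_bigr => j Pj.
have [->|nij] := eqVneq i j; first by rewrite trB2 // rmorph0 mul0r !mulr0.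
rewrite partial_fraction_mul -/(fr _) -/(fr _) -?rmorphB.
  by rewrite -mulrA (mulrC _^-1).
by apply: contra nij => /eqP /affine_inj ->.
Qed.

(* The equations omit the marked points 1 and 0; there r vanishes as soon as it
   vanishes elsewhere, because the sums of r i and of x i * r i are zero. *)
Lemma cone_equationsP : \tr ((\sum_(i | P i) B i) *m (\sum_(i | P i) B i)) = 0 ->
  \tr (polar_part hn z B *m polar_part hn z B) = 0 <-> cone_equations hn z B.
Proof.
move=> trS; have two0 : (2%:R : R[i]) != 0 by rewrite pnatr_eq0.
have r_cone : cone_equations hn z B <-> forall i : 'I_n, (i < n - 3)%N -> r i = 0.
  by [].
rewrite r_cone tr_sqr_polar_part; split=> [S0 i lt_i|r0].
  have Pi : P i by rewrite /P -val_eqE /=; lia.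
  by apply: (mulfI two0); rewrite mulr0; exact: (partial_fractions_free affine_inj S0).
have t_sym i j : \tr (B i *m B j) = \tr (B j *m B i) by rewrite mxtrace_mulC.
have m0 : \sum_(i | P i) r i = 0.
  exact: (@pair_sum0 _ _ P x two0 _ t_sym trB2).
have m1 : \sum_(i | P i) x i * r i = 0.
  apply: (mulfI two0); rewrite mulr0.
  rewrite (@pair_sum1 _ _ P x affine_inj _ t_sym trB2) -[RHS]trS.
  rewrite mulmx_suml raddf_sum; apply: eq_bigr => i _.
  by rewrite mulmx_sumr raddf_sum.
pose i1 := from_last hn 2; pose i0 := from_last hn 1.
(* Indices start at 0: removing n-1, n-2 and n-3, the points at infinity, 0 and 1, leaves those
   below n-3. *)
have r_other i : P i -> i != i1 -> i != i0 -> r i = 0.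
  by rewrite /P -!val_eqE /= => *; apply: r0; have := ltn_ord i; lia.
have P1 : P i1 by rewrite /P -val_eqE /=; lia.
have P0 : P i0 by rewrite /P -val_eqE /=; lia.
have n01 : i0 != i1 by rewrite -val_eqE /=; lia.
have split2 (w : 'I_n -> R[i]) :
    \sum_(i | P i) w i * r i = w i1 * r i1 + w i0 * r i0.
  rewrite (bigD1 i1) //= (bigD1 i0) ?P0 //= big1 ?addr0 // => i.
  by case/andP=> /andP[Pi ni1] ni0; rewrite r_other ?mulr0.
(* With coordinates 1 and 0, the weighted sum [m1] isolates [r i1]; then [m0] gives [r i0]. *)
have r1 : r i1 = 0.
  by move: m1; rewrite split2 /x z_one z_zero /= mul1r mul0r addr0.
have r00 : r i0 = 0.
  move: m0; under eq_bigr do rewrite -[r _]mul1r.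
  by rewrite (split2 (fun=> 1)) r1 mulr0 add0r mul1r.
rewrite big1 // => i Pi; have [->|n1] := eqVneq i i1.
  by rewrite r1 mulr0 rmorph0 mulr0.
have [->|n0] := eqVneq i i0; first by rewrite r00 mulr0 rmorph0 mulr0.
by rewrite r_other // mulr0 rmorph0 mulr0.
Qed.

End Residues.

Lemma value_at_infty_polar_part (B : 'I_n -> 'M[R[i]]_2) a b :
  value_at_infty (tofrac 'X * polar_part hn z B a b) (\sum_(i | P i) B i a b).
Proof.
rewrite polar_partE mulr_sumr; apply: value_at_infty_sum => i _.
exact: value_at_infty_pole.
Qed.

Lemma tr_sqr_Bmx (c u : R[i]) : \tr (Bmx c u *m Bmx c u) = 0.
Proof. by rewrite /mxtrace big_ord2 !mulmx22 !mxE /=; ring. Qed.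

(** The first limit reads [c N * u N ^+ 2] off [Phi] alone, so that two choices of parameters can be
    compared. The sums come from the first row of the pole condition, where conjugation fixes entry
    (0, 0) and multiplies entry (0, 1) by [X]. *)
Lemma H_odd_infty k (Phi : ratmx R) (c u : 'I_n -> R[i]) :
  H_odd hn z k Phi c u -> let N := from_last hn 0 in
  [/\ value_at_infty (Phi 1 0) (c N * u N ^+ 2),
      \sum_(i | P i) c i * u i = - (c N * u N)
    & \sum_(i | P i) c i = 0].
Proof.
pose X : {fraction {poly R[i]}} := tofrac 'X.
pose D : ratmx R := mx2 (X ^+ k.+1) 0 0 (X ^+ k).
case=> EPhi pole N.
change (simple_pole_at_infty (D *m Phi *m invmx D) (Bmx (c N) (u N))) in pole.
have X0 : X != 0 by rewrite tofrac_eq0 polyX_eq0.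
have [E00 E01] := conj_diag_powers k Phi X0.
have Phi0 b : Phi 0 b = polar_part hn z (fun i => Bmx (c i) (u i)) 0 b.
  rewrite EPhi mxE [X in _ + X]mxE !mxE /=.
  by case: ifP => _; rewrite mulr0 rmorph0 addr0.
have Phi10 : Phi 1 0 =
    polar_part hn z (fun i => Bmx (c i) (u i)) 1 0 + ratC (c N * u N ^+ 2).
  by rewrite EPhi !mxE.
split.
- rewrite Phi10 -[X in value_at_infty _ X]add0r.
  apply: value_at_inftyD; last exact: value_at_infty_const.
  by apply: value_at_infty_decay; exact: value_at_infty_polar_part.
- have := pole 0 0; rewrite [X in value_at_infty (- (_ * X))]E00 Phi0 => v.
  have := value_at_infty_uniq v (value_at_inftyN (@value_at_infty_polar_part _ 0 0)).
  under [in RHS]eq_bigr do rewrite !mxE /= mulrN.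
  by rewrite !mxE /= mulrN sumrN opprK => <-.
(* X^2 Phi_01 has a finite limit, so X Phi_01, whose limit is the sum of the c_i, tends to 0. *)
have := value_at_inftyN (pole 0 1).
rewrite [X in value_at_infty (- - (_ * X))]E01 opprK Phi0.
move/value_at_infty_decay => v.
have := value_at_infty_uniq (@value_at_infty_polar_part _ 0 1) v.
by under eq_bigr do rewrite !mxE /= mulr1.
Qed.

End ConeEquations.

(** * Invariance of the trace under automorphisms *)

Lemma tr_sqr_orbit (R : realType) (n : nat) (z : 'I_n -> CP1 R)
    (a : 'I_2 -> int) (g : bundle_hom R a a) (x : higgs_pair R n) :
  is_automorphism g ->
  \tr ((aut_act z g x).2 *m (aut_act z g x).2) = \tr (x.2 *m x.2).
Proof.
move=> g_aut /=; set G := map_mx _ _.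
have G_unit : G \in unitmx.
  (* The determinant of [hom0 g] is a nonzero polynomial, as [g] is invertible on the fiber at 0. *)
  rewrite unitmxE det_map_mx unitfE tofrac_eq0; apply: contraTneq (g_aut (Some 0)).
  rewrite /= -[fun q : {poly _} => _]/(horner_eval (0 : R[i])) => det0.
  by rewrite unitmxE det_map_mx det0 rmorph0 unitr0.
by rewrite !mulmxA mulmxKV // -(mulmxA G) mxtrace_mulC mulKmx.
Qed.

Program Definition bundle_id (R : realType) (a : 'I_2 -> int) : bundle_hom R a a :=
  @BundleHom R 2 2 a a 1%:M 1%:M _.
Next Obligation.
rewrite !mxE; have [->|_] := eqVneq i j; last by rewrite !hornerE ?mulr0.
by rewrite subrr expr0z !hornerE.
Qed.

Lemma bundle_id_aut (R : realType) (a : 'I_2 -> int) :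
  is_automorphism (bundle_id R a).
Proof.
by case=> [x|] /=; rewrite -[fun q : {poly _} => _]/(horner_eval _) map_mx1
  unitmx1.
Qed.

Lemma nilpotent_cone_orbit (R : realType) (n : nat) (z : 'I_n -> CP1 R)
    (a : 'I_2 -> int) (Q : set (higgs_pair R n)) (x : higgs_pair R n) :
  Q x -> nilpotent_cone z a Q (orbit z a x) <-> \tr (x.2 *m x.2) = 0.
Proof.
move=> Qx; split=> [[_ [y [_ yx y0]]]|x0]; last by split; exists x.
(* The orbits of [x] and [y] are equal, so the identity translate of [x] is also a translate of [y]
   and has the trace of both. *)
have : orbit z a y (aut_act z (bundle_id R a) x).
  by rewrite yx; exists (bundle_id R a) => //; exact: bundle_id_aut.
case=> g g_aut E; rewrite -(tr_sqr_orbit z x (@bundle_id_aut R a)) E.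
by rewrite tr_sqr_orbit.
Qed.

Theorem corollary1 (R : realType) (n : nat) (hn : (3 < n)%N)
    (z : 'I_n -> CP1 R) (z_inj : injective z)
    (z_one : z (from_last hn 2) = Some 1)
    (z_zero : z (from_last hn 1) = Some 0)
    (z_infty : z (from_last hn 0) = None)
    (al1 al2 : 'I_n -> R) (al_weights : is_weights al1 al2) (k : nat) :
  ((1 <= k <= n - 1)%N ->
   \sum_i (al1 i + al2 i) = k.*2%:R ->
   k%:R - 1 < \sum_i al1 i ->
   (forall i j : 'I_n, (n - 3 <= i)%N -> (n - 3 <= j)%N -> i != j ->
      k%:R < al2 i + al2 j + \sum_(l | (l != i) && (l != j)) al1 l) ->
   forall (x : higgs_pair R n) (B : 'I_n -> 'M[R[i]]_2),
     Q_even hn z k al1 al2 x ->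
     normalized_even hn x ->
     H_even hn z x.2 B ->
     (nilpotent_cone z (E_even k) (Q_even hn z k al1 al2)
        (orbit z (E_even k) x) <-> cone_equations hn z B)
     /\ (\tr (x.2 *m x.2) = 0 <-> cone_equations hn z B))
  /\
  ((1 <= k <= n - 2)%N ->
   \sum_i (al1 i + al2 i) = k.*2.+1%:R ->
   k%:R - 1 < \sum_i al1 i < k%:R ->
   (forall i : 'I_n, k%:R < al2 i + \sum_(j | j != i) al1 j) ->
   forall (x : higgs_pair R n) (c u : 'I_n -> R[i]),
     Q_odd hn z k al1 al2 x ->
     normalized_odd hn x ->
     H_odd hn z k x.2 c u ->
     (nilpotent_cone z (E_odd k) (Q_odd hn z k al1 al2)
        (orbit z (E_odd k) x)
        <-> cone_equations hn z (fun i => Bmx (c i) (u i)))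
     /\ (\tr (x.2 *m x.2) = 0
        <-> cone_equations hn z (fun i => Bmx (c i) (u i)))).
Proof.
split=> _ _ _ _ x => [B Qx _ [Bnil BN Phi_eq] | c u Qx [_ xN] Hx].
  rewrite nilpotent_cone_orbit //.
  suff E : \tr (x.2 *m x.2) = 0 <-> cone_equations hn z B by [].
  rewrite Phi_eq; apply: cone_equationsP => // [i _|].
    exact: tr_sqr_nilpotent.
  (* By [BN] the sum of the finite residues is minus the nilpotent residue at infinity. *)
  rewrite -[X in X *m _]opprK -[X in _ *m X]opprK -BN mulNmx mulmxN opprK.
  exact: tr_sqr_nilpotent.
rewrite nilpotent_cone_orbit //.
suff E : \tr (x.2 *m x.2) = 0 <->
    cone_equations hn z (fun i => Bmx (c i) (u i)) by [].
have [v10 sum_cu sum_c] := H_odd_infty Hx.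
(* The witnesses [c'], [u'] of [Qx] may differ from [c], [u], but [Phi] determines c_n u_n^2. For
   [c'], [u'] the residue at infinity kills the normalized line spanned by (1, 0), so its lower left
   entry -c'_n u'_n^2 vanishes. *)
have cuN : c (from_last hn 0) * u (from_last hn 0) ^+ 2 = 0.
  case: Qx => _ [c' [u' [Hx' flagN]]]; have [v10' _ _] := H_odd_infty Hx'.
  rewrite (value_at_infty_uniq v10 v10').
  have [_ /(_ (col2 1 0))] := flagN (from_last hn 0).
  rewrite xN memv_line => /(_ isT)/matrixP/(_ 1 0).
  rewrite !mxE big_ord2 !mxE /= mulr1 mulr0 addr0 mulrN => /eqP.
  by rewrite oppr_eq0 => /eqP.
have cuN1 : c (from_last hn 0) * u (from_last hn 0) = 0.
  by apply/eqP; move/eqP: cuN; rewrite expr2 !mulf_eq0 orbb.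
have [-> _] := Hx.
have -> : c (from_last hn 0) *: mx2 0 0 (u (from_last hn 0) ^+ 2) 0 = 0.
  apply/matrixP=> a b; rewrite !mxE.
  by do 2!case: ifP => _; rewrite ?mulr0 ?cuN.
rewrite map_mx0 addr0; apply: cone_equationsP => // [i _|].
  exact: tr_sqr_Bmx.
(* Only the lower left entry of the sum of the finite residues can be nonzero, so its square has
   trace zero. *)
rewrite /mxtrace big_ord2 !mulmx22 !summxE.
have s00 : \sum_(i | i != from_last hn 0) Bmx (c i) (u i) 0 0 = 0.
  under eq_bigr do rewrite !mxE /= mulrN.
  by rewrite sumrN sum_cu cuN1 !oppr0.
have s01 : \sum_(i | i != from_last hn 0) Bmx (c i) (u i) 0 1 = 0.
  by under eq_bigr do rewrite !mxE /= mulr1.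
have s11 : \sum_(i | i != from_last hn 0) Bmx (c i) (u i) 1 1 = 0.
  by under eq_bigr do rewrite !mxE /=; rewrite sum_cu cuN1 oppr0.
by rewrite s00 s01 s11 !mul0r !mulr0 !addr0.
Qed.
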